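(* For every non-degenerate quadric surface of revolution in $\mathbb S^3$ there is a constant $\mu\neq0$ such that its principal curvatures satisfy the cubic Weingarten relation $k_{\mathrm m}=\mu\,k_{\mathrm p}^3$ (at the points where the generating curve has $z\neq0$).
   Context: $\mathbb S^2\subset\mathbb R^3$ and $\mathbb S^3\subset\mathbb R^4$ are the unit spheres. For a smooth unit-speed curve $\xi=(x,y,z):I\to\mathbb S^2$, the rotational surface generated by $\xi$ is $S_\xi$: $X(s,t)=(x(s),y(s),z(s)\cos t,z(s)\sin t)\in\mathbb S^3$. Where $z\ne0$ its principal curvatures along meridians and parallels are $k_{\mathrm m}=\kappa$ and $k_{\mathrm p}=(\dot x y-x\dot y)/z$, where $\kappa=\det(\xi,\dot\xi,\ddot\xi)$ is the geodesic curvature of $\xi$. For a one-dimensional subset $\mathcal C\subset\mathbb S^2$, $S_{\mathcal C}$ is the surface obtained by rotating $\mathcal C$ in this way. The non-degenerate quadric surfaces of revolution are the surfaces generated by the spherical conics $$\mathcal{CV}_{AB}=\mathbb S^2\cap\Big\{\tfrac{x^2}{A^2}+\tfrac{y^2}{B^2}=1\Big\},\qquad \mathcal{CH}_{CD}=\mathbb S^2\cap\Big\{\tfrac{x^2}{C^2}+\tfrac{z^2}{D^2}=1\Big\}\qquad(A,B,C,D>0)$$ in the following cases: (I) one-piece spherical hyperboloids of revolution: $S_{\mathcal{CH}_{CD}}$ with $D<1<C$ (equivalently $S_{\mathcal{CV}_{AB}}$ with $B<A<1$); (IIa) two-piece spherical hyperboloids of revolution: $S_{\mathcal{CV}_{AB}}$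 with $B<1<A$ (equivalently $S_{\mathcal{CH}_{CD}}$ with $D<C<1$); (IIb) prolate spherical ellipsoids of revolution: $S_{\mathcal{CV}_{AB}}$ with $A<1<B$; (III) oblate spherical ellipsoids of revolution: $S_{\mathcal{CH}_{CD}}$ with $C<1<D$. *)

(* Defs.v *)
From Stdlib Require Import Reals Lra Nsatz.
From Coquelicot Require Import Coquelicot.
Open Scope R_scope.

Definition vec3 : Type := (R * R * R)%type.
Definition vec4 : Type := (R * R * R * R)%type.

Definition cx (v : vec3) : R := fst (fst v).
Definition cy (v : vec3) : R := snd (fst v).
Definition cz (v : vec3) : R := snd v.

Definition c1 (v : vec4) : R := fst (fst (fst v)).
Definition c2 (v : vec4) : R := snd (fst (fst v)).
Definition c3 (v : vec4) : R := snd (fst v).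
Definition c4 (v : vec4) : R := snd v.

Definition dot4 (u v : vec4) : R :=
  c1 u * c1 v + c2 u * c2 v + c3 u * c3 v + c4 u * c4 v.

Definition derive3 (f : R -> vec3) (s : R) : vec3 :=
  (Derive (fun r => cx (f r)) s,
   Derive (fun r => cy (f r)) s,
   Derive (fun r => cz (f r)) s).

Definition derive4 (f : R -> vec4) (s : R) : vec4 :=
  (Derive (fun r => c1 (f r)) s,
   Derive (fun r => c2 (f r)) s,
   Derive (fun r => c3 (f r)) s,
   Derive (fun r => c4 (f r)) s).

Definition det3 (u v w : vec3) : R :=
  cx u * (cy v * cz w - cz v * cy w)
  - cy u * (cx v * cz w - cz v * cx w)
  + cz u * (cx v * cy w - cy v * cx w).

Definition sphere2 (p : vec3) : Prop := cx p ^ 2 + cy p ^ 2 + cz p ^ 2 = 1.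

(** ** Smooth unit-speed curves, defined on a possibly unbounded open interval *)

Definition in_interval (a b : Rbar) (s : R) : Prop := Rbar_lt a s /\ Rbar_lt s b.

Definition smooth_on (a b : Rbar) (xi : R -> vec3) : Prop :=
  forall (n : nat) (s : R), in_interval a b s ->
    ex_derive_n (fun r => cx (xi r)) n s /\
    ex_derive_n (fun r => cy (xi r)) n s /\
    ex_derive_n (fun r => cz (xi r)) n s.

Definition unit_speed_on (a b : Rbar) (xi : R -> vec3) : Prop :=
  forall s : R, in_interval a b s ->
    cx (derive3 xi s) ^ 2 + cy (derive3 xi s) ^ 2 + cz (derive3 xi s) ^ 2 = 1.

Definition curve_in (a b : Rbar) (xi : R -> vec3) (C : vec3 -> Prop) : Prop :=
  forall s : R, in_interval a b s -> C (xi s).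

(** ** Curvature of parametrized surfaces in the unit sphere of [vec4] *)

Definition patch : Type := R -> R -> vec4.

Definition Ds (X : patch) : patch := fun s t => derive4 (fun r => X r t) s.
Definition Dt (X : patch) : patch := fun s t => derive4 (fun r => X s r) t.

(** The normal of the surface inside S^3 is orthogonal to the position vector
    as well as to the tangent plane; it is determined up to sign. *)
Definition unit_normal (X : patch) (s t : R) (nu : vec4) : Prop :=
  dot4 nu nu = 1 /\ dot4 nu (X s t) = 0 /\
  dot4 nu (Ds X s t) = 0 /\ dot4 nu (Dt X s t) = 0.

(** A tangent vector [v] stands for [fst v * Ds X + snd v * Dt X]. *)
Definition first_form (X : patch) (s t : R) (v w : R * R) : R :=
  fst v * fst w * dot4 (Ds X s t) (Ds X s t)
  + (fst v * snd w + snd v * fst w) * dot4 (Ds X s t) (Dt X s t)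
  + snd v * snd w * dot4 (Dt X s t) (Dt X s t).

(** Since [nu] is orthogonal to the position vector, the second derivatives in
    R^4 have the same [nu]-component as the covariant derivatives of S^3. *)
Definition second_form (X : patch) (s t : R) (nu : vec4) (v w : R * R) : R :=
  fst v * fst w * dot4 (Ds (Ds X) s t) nu
  + (fst v * snd w + snd v * fst w) * dot4 (Dt (Ds X) s t) nu
  + snd v * snd w * dot4 (Dt (Dt X) s t) nu.

(** [v] is an eigenvector, with eigenvalue [k], of the shape operator
    associated with [nu]. *)
Definition principal_curvature
    (X : patch) (s t : R) (nu : vec4) (v : R * R) (k : R) : Prop :=
  v <> (0, 0) /\
  forall w : R * R, second_form X s t nu v w = k * first_form X s t v w.

(** ** Rotational surfaces *)

Definition rot_surface (xi : R -> vec3) : patch := fun s t =>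
  (cx (xi s), cy (xi s), cz (xi s) * cos t, cz (xi s) * sin t).

Definition meridian : R * R := (1, 0).
Definition parallel : R * R := (0, 1).

(** ** Spherical conics *)

Definition CV (A B : R) (p : vec3) : Prop :=
  sphere2 p /\ cx p ^ 2 / A ^ 2 + cy p ^ 2 / B ^ 2 = 1.

Definition CH (C D : R) (p : vec3) : Prop :=
  sphere2 p /\ cx p ^ 2 / C ^ 2 + cz p ^ 2 / D ^ 2 = 1.

(** The spherical conics generating the non-degenerate quadric surfaces of
    revolution.  The one-piece hyperboloids are also given by [CV A B] with
    [B < A < 1], and the two-piece ones by [CH C D] with [D < C < 1]. *)
Inductive nondegenerate_quadric_conic : (vec3 -> Prop) -> Prop :=
| one_piece_hyperboloid (C D : R) :
    0 < D -> D < 1 -> 1 < C -> nondegenerate_quadric_conic (CH C D)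
| two_piece_hyperboloid (A B : R) :
    0 < B -> B < 1 -> 1 < A -> nondegenerate_quadric_conic (CV A B)
| prolate_ellipsoid (A B : R) :
    0 < A -> A < 1 -> 1 < B -> nondegenerate_quadric_conic (CV A B)
| oblate_ellipsoid (C D : R) :
    0 < C -> C < 1 -> 1 < D -> nondegenerate_quadric_conic (CH C D).

(** ** Explicit principal curvatures of a rotational surface *)

Definition geodesic_curvature (xi : R -> vec3) (s : R) : R :=
  det3 (xi s) (derive3 xi s) (derive3 (derive3 xi) s).

Definition k_m (xi : R -> vec3) (s : R) : R := geodesic_curvature xi s.

Definition k_p (xi : R -> vec3) (s : R) : R :=
  (cx (derive3 xi s) * cy (xi s) - cx (xi s) * cy (derive3 xi s)) / cz (xi s).

(** The cross product of [xi] and its velocity, rotated by the angle [t]. *)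
Definition rot_normal (xi : R -> vec3) (s t : R) : vec4 :=
  let p := xi s in
  let v := derive3 xi s in
  (cy p * cz v - cz p * cy v,
   cz p * cx v - cx p * cz v,
   (cx p * cy v - cy p * cx v) * cos t,
   (cx p * cy v - cy p * cx v) * sin t).

Lemma Ds_rot_surface (xi : R -> vec3) (s t : R) :
  Ds (rot_surface xi) s t = rot_surface (derive3 xi) s t.
Proof.
unfold Ds, derive4, rot_surface, derive3, c1, c2, c3, c4, cx, cy, cz; simpl.
now rewrite !Derive_scal_l.
Qed.

Lemma Dt_rot_surface (xi : R -> vec3) (s t : R) :
  Dt (rot_surface xi) s t = (0, 0, - (cz (xi s) * sin t), cz (xi s) * cos t).
Proof.
unfold Dt, derive4, rot_surface, c1, c2, c3, c4; simpl.
rewrite !Derive_const, !Derive_scal.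
rewrite (is_derive_unique _ _ _ (is_derive_cos t)).
rewrite (is_derive_unique _ _ _ (is_derive_sin t)).
repeat f_equal; ring.
Qed.

Lemma derive4_ext (f g : R -> vec4) (s : R) :
  (forall r, f r = g r) -> derive4 f s = derive4 g s.
Proof.
intros H; unfold derive4.
rewrite (Derive_ext (fun r => c1 (f r)) (fun r => c1 (g r))) by (intros r; now rewrite H).
rewrite (Derive_ext (fun r => c2 (f r)) (fun r => c2 (g r))) by (intros r; now rewrite H).
rewrite (Derive_ext (fun r => c3 (f r)) (fun r => c3 (g r))) by (intros r; now rewrite H).
now rewrite (Derive_ext (fun r => c4 (f r)) (fun r => c4 (g r))) by (intros r; now rewrite H).
Qed.

Lemma Dst_rot_surface (xi : R -> vec3) (s t : R) :
  Dt (Ds (rot_surface xi)) s t =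
  (0, 0, - (cz (derive3 xi s) * sin t), cz (derive3 xi s) * cos t).
Proof.
rewrite <- Dt_rot_surface; unfold Dt.
apply derive4_ext; intros r; apply Ds_rot_surface.
Qed.

Lemma Dss_rot_surface (xi : R -> vec3) (s t : R) :
  Ds (Ds (rot_surface xi)) s t = rot_surface (derive3 (derive3 xi)) s t.
Proof.
rewrite <- Ds_rot_surface; unfold Ds at 1 3.
apply derive4_ext; intros r; apply Ds_rot_surface.
Qed.

Lemma Dtt_rot_surface (xi : R -> vec3) (s t : R) :
  Dt (Dt (rot_surface xi)) s t =
  (0, 0, - (cz (xi s) * cos t), - (cz (xi s) * sin t)).
Proof.
unfold Dt at 1; rewrite (derive4_ext _ _ _ (Dt_rot_surface xi s)).
unfold derive4, c1, c2, c3, c4; simpl.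
rewrite !Derive_const, Derive_opp, !Derive_scal.
rewrite (is_derive_unique _ _ _ (is_derive_cos t)).
rewrite (is_derive_unique _ _ _ (is_derive_sin t)).
repeat f_equal; ring.
Qed.

Lemma is_derive_sum_sqr (f g h : R -> R) (s X Y Z : R) :
  is_derive f s X -> is_derive g s Y -> is_derive h s Z ->
  is_derive (fun r => f r ^ 2 + g r ^ 2 + h r ^ 2) s
    (2 * X * f s + 2 * Y * g s + 2 * Z * h s).
Proof.
intros HX HY HZ; auto_derive.
- repeat split; eexists; eassumption.
- apply is_derive_unique in HX; apply is_derive_unique in HY; apply is_derive_unique in HZ.
  rewrite <- HX, <- HY, <- HZ.
  change (Derive (fun r => f r) s) with (Derive f s).
  change (Derive (fun r => g r) s) with (Derive g s).
  change (Derive (fun r => h r) s) with (Derive h s).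
  ring.
Qed.

Lemma rot_surface_principal_curvatures (a b : Rbar) (xi : R -> vec3) :
  smooth_on a b xi -> unit_speed_on a b xi -> curve_in a b xi sphere2 ->
  forall s t : R, in_interval a b s -> cz (xi s) <> 0 ->
  unit_normal (rot_surface xi) s t (rot_normal xi s t) /\
  principal_curvature (rot_surface xi) s t (rot_normal xi s t) meridian (k_m xi s) /\
  principal_curvature (rot_surface xi) s t (rot_normal xi s t) parallel (k_p xi s).
Proof.
intros Hsm Hu HS s t Hs Hz.
assert (Hp := HS s Hs); assert (Hv := Hu s Hs).
assert (Hpv : cx (xi s) * cx (derive3 xi s) + cy (xi s) * cy (derive3 xi s)
              + cz (xi s) * cz (derive3 xi s) = 0).
{ destruct (Hsm 1%nat s Hs) as [[X HX] [[Y HY] [Z HZ]]].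
  change (is_derive (fun r => cx (xi r)) s X) in HX.
  change (is_derive (fun r => cy (xi r)) s Y) in HY.
  change (is_derive (fun r => cz (xi r)) s Z) in HZ.
  assert (E := is_derive_sum_sqr _ _ _ _ _ _ _ HX HY HZ).
  assert (L : locally s (fun r => 1 = cx (xi r) ^ 2 + cy (xi r) ^ 2 + cz (xi r) ^ 2)).
  { assert (O : open (in_interval a b)).
    { apply open_and; [apply open_Rbar_gt | apply open_Rbar_lt]. }
    apply (filter_imp (in_interval a b)); [|exact (O s Hs)]; intros r Hr; symmetry; exact (HS r Hr). }
  assert (E0 : is_derive (fun r => cx (xi r) ^ 2 + cy (xi r) ^ 2 + cz (xi r) ^ 2) s 0).
  { apply (is_derive_ext_loc (fun _ => 1)); [exact L | exact (is_derive_const 1 s)]. }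
  apply is_derive_unique in E; apply is_derive_unique in E0.
  assert (EX : Derive (fun r => cx (xi r)) s = X) by exact (is_derive_unique _ _ _ HX).
  assert (EY : Derive (fun r => cy (xi r)) s = Y) by exact (is_derive_unique _ _ _ HY).
  assert (EZ : Derive (fun r => cz (xi r)) s = Z) by exact (is_derive_unique _ _ _ HZ).
  change (cx (xi s) * Derive (fun r => cx (xi r)) s
    + cy (xi s) * Derive (fun r => cy (xi r)) s
    + cz (xi s) * Derive (fun r => cz (xi r)) s = 0).
  rewrite EX, EY, EZ; rewrite E in E0; clear - E0; lra. }
assert (Ht := sin2_cos2 t); unfold Rsqr in Ht.
unfold unit_normal, principal_curvature, first_form, second_form.
rewrite Dss_rot_surface, Dst_rot_surface, Dtt_rot_surface,
  Ds_rot_surface, Dt_rot_surface.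
unfold k_m, geodesic_curvature, det3, k_p, rot_normal, rot_surface, dot4,
  meridian, parallel, sphere2 in *.
generalize dependent (derive3 (derive3 xi) s).
generalize dependent (derive3 xi s); generalize dependent (xi s).
intros [[x y] z] Hz Hp [[x' y'] z'] Hv Hpv [[x'' y''] z''].
unfold cx, cy, cz, c1, c2, c3, c4 in *; simpl in *.
generalize dependent (cos t); generalize dependent (sin t); intros S C Ht.
split; [|split].
- repeat split; nsatz.
- split; [intros E; injection E; lra|].
  intros [w1 w2]; simpl; nsatz.
- split; [intros E; injection E; lra|].
  intros [w1 w2]; simpl.
  assert (Hk := Rmult_inv_r z Hz); unfold Rdiv.
  generalize dependent (/ z); intros i Hi; nsatz.
Qed.

(* Main.v *)
Require Import Defs.
From Stdlib Require Import Reals.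
From Coquelicot Require Import Coquelicot.
From Stdlib Require Import Lra.
Open Scope R_scope.

(** Subtracting the equation of the sphere from that of the conic shows that
    the curve lies on a quadratic cone [Q(p,p) = 0] whose matrix
    [Q = diag (q1, q2, q3)] is invertible; this is where non-degeneracy enters,
    and it treats all the types of conics at once.

    Let [p] be the position, [v] the velocity and [a] the acceleration of the
    curve, and let [n] be the unit normal of the surface, rotated back to the
    angle [t = 0], where its fourth coordinate vanishes, so that it is a vector
    of R^3.  Then [p], [v], [n] are orthonormal.  Differentiating [Q(p,p) = 0]
    gives [Q(p,v) = 0] and [Q(v,v) + Q(p,a) = 0], so [Q p] is
    orthogonal to [p] and to [v], that is [Q p = l n] with [l = Q(p,n)].
    - The third coordinate reads [q3 z = l n3], so [k_p = - n3 / z = - q3 / l].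
    - Pairing with [a] gives [l k_m = l (n . a) = Q(p,a) = - Q(v,v)].
    - In the frame [p], [v], [n] the matrix of [Q] is
      [[0, 0, l], [0, Q(v,v), *], [l, *, *]], whose determinant is
      [- l^2 Q(v,v)]; hence [l^2 Q(v,v) = - q1 q2 q3] and [l <> 0].

    Altogether [k_m = q1 q2 q3 / l^3 = - (q1 q2 / q3^2) k_p^3].  Both curvatures
    change sign with [n], and the relation is odd, so the choice of the normal
    is immaterial. *)

(** * Diagonal bilinear forms on R^3 *)

Definition diag_form (q u v : vec3) : R :=
  cx q * cx u * cx v + cy q * cy u * cy v + cz q * cz u * cz v.

Definition dot3 : vec3 -> vec3 -> R := diag_form (1, 1, 1).

Definition orthonormal (p v n : vec3) : Prop :=
  dot3 p p = 1 /\ dot3 v v = 1 /\ dot3 n n = 1 /\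
  dot3 p v = 0 /\ dot3 p n = 0 /\ dot3 v n = 0.

(** The matrix of the form in the family [p], [v], [n] is congruent to
    [diag q], so its determinant is that of [diag q] times [det3 p v n ^ 2]. *)
Lemma diag_form_gram_det (q p v n : vec3) :
  let g := diag_form q in
  g p p * (g v v * g n n - g v n ^ 2)
  - g p v * (g p v * g n n - g v n * g p n)
  + g p n * (g p v * g v n - g v v * g p n)
  = cx q * cy q * cz q * det3 p v n ^ 2.
Proof. unfold diag_form, det3; simpl; ring. Qed.

Lemma orthonormal_det_sqr (p v n : vec3) :
  orthonormal p v n -> det3 p v n ^ 2 = 1.
Proof.
intros (Hp & Hv & Hn & Hpv & Hpn & Hvn).
assert (G := diag_form_gram_det (1, 1, 1) p v n); cbv zeta in G.
fold dot3 in G; rewrite Hp, Hv, Hn, Hpv, Hpn, Hvn in G.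
unfold cx at 1, cy at 1, cz at 1 in G; cbn [fst snd] in G.
lra.
Qed.

(** Cramer's rule for a homogeneous system with matrix [(p, v, n)]. *)
Lemma orthogonal_to_basis (p v n u : vec3) :
  det3 p v n <> 0 -> dot3 u p = 0 -> dot3 u v = 0 -> dot3 u n = 0 ->
  u = (0, 0, 0).
Proof.
destruct p as [[p1 p2] p3], v as [[v1 v2] v3], n as [[n1 n2] n3], u as [[u1 u2] u3].
intros Hd Hp Hv Hn.
assert (E1 : det3 (p1, p2, p3) (v1, v2, v3) (n1, n2, n3) * u1 =
  dot3 (u1, u2, u3) (p1, p2, p3) * (v2 * n3 - v3 * n2)
  + dot3 (u1, u2, u3) (v1, v2, v3) * (n2 * p3 - n3 * p2)
  + dot3 (u1, u2, u3) (n1, n2, n3) * (p2 * v3 - p3 * v2))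
  by (unfold det3, dot3, diag_form, cx, cy, cz; simpl; ring).
assert (E2 : det3 (p1, p2, p3) (v1, v2, v3) (n1, n2, n3) * u2 =
  dot3 (u1, u2, u3) (p1, p2, p3) * (v3 * n1 - v1 * n3)
  + dot3 (u1, u2, u3) (v1, v2, v3) * (n3 * p1 - n1 * p3)
  + dot3 (u1, u2, u3) (n1, n2, n3) * (p3 * v1 - p1 * v3))
  by (unfold det3, dot3, diag_form, cx, cy, cz; simpl; ring).
assert (E3 : det3 (p1, p2, p3) (v1, v2, v3) (n1, n2, n3) * u3 =
  dot3 (u1, u2, u3) (p1, p2, p3) * (v1 * n2 - v2 * n1)
  + dot3 (u1, u2, u3) (v1, v2, v3) * (n1 * p2 - n2 * p1)
  + dot3 (u1, u2, u3) (n1, n2, n3) * (p1 * v2 - p2 * v1))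
  by (unfold det3, dot3, diag_form, cx, cy, cz; simpl; ring).
rewrite Hp, Hv, Hn in E1, E2, E3.
repeat f_equal; apply (Rmult_eq_reg_l (det3 (p1, p2, p3) (v1, v2, v3) (n1, n2, n3)));
  trivial; lra.
Qed.

(** The vector [diag q p] is orthogonal to [p] and [v], hence along [n]. *)
Lemma cone_gradient_along_normal (q p v n : vec3) :
  orthonormal p v n -> diag_form q p p = 0 -> diag_form q p v = 0 ->
  (cx q * cx p, cy q * cy p, cz q * cz p) =
  (diag_form q p n * cx n, diag_form q p n * cy n, diag_form q p n * cz n).
Proof.
intros F Hpp Hpv.
assert (D := orthonormal_det_sqr _ _ _ F).
destruct F as (Hp & Hv & Hn & Hpv' & Hpn & Hvn).
set (l := diag_form q p n).
assert (E : (cx q * cx p - l * cx n, cy q * cy p - l * cy n,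
             cz q * cz p - l * cz n) = (0, 0, 0)).
{ assert (L : forall w,
    dot3 (cx q * cx p - l * cx n, cy q * cy p - l * cy n, cz q * cz p - l * cz n) w
    = diag_form q p w - l * dot3 w n)
    by (intros w; unfold dot3, diag_form, cx, cy, cz; simpl; ring).
  apply (orthogonal_to_basis p v n).
  - intros Z; rewrite Z in D; lra.
  - rewrite L, Hpp, Hpn; ring.
  - rewrite L, Hpv, Hvn; ring.
  - rewrite L, Hn; unfold l; ring. }
injection E; intros E3 E2 E1.
rewrite (Rminus_diag_uniq _ _ E1), (Rminus_diag_uniq _ _ E2), (Rminus_diag_uniq _ _ E3).
reflexivity.
Qed.

(** Determinant of the form in the frame, where its first row is [(0, 0, l)]. *)
Lemma cone_tangent_value (q p v n : vec3) :
  orthonormal p v n -> diag_form q p p = 0 -> diag_form q p v = 0 ->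
  diag_form q p n ^ 2 * diag_form q v v = - (cx q * cy q * cz q).
Proof.
intros F Hpp Hpv.
assert (G := diag_form_gram_det q p v n); cbv zeta in G.
rewrite (orthonormal_det_sqr _ _ _ F), Hpp, Hpv in G; lra.
Qed.

(** * The cubic relation at a point of a cone *)

(** The hypothesis on [kp] is [k_p = - n3 / z] multiplied by [z ^ 2], the form
    in which it comes out of the two fundamental forms. *)
Lemma cone_cubic_relation (q p v a n : vec3) (km kp : R) :
  cx q <> 0 -> cy q <> 0 -> cz q <> 0 -> orthonormal p v n -> cz p <> 0 ->
  diag_form q p p = 0 -> diag_form q p v = 0 ->
  diag_form q v v + diag_form q p a = 0 ->
  km = dot3 a n -> kp * cz p ^ 2 = - (cz p * cz n) ->
  km = - (cx q * cy q) / cz q ^ 2 * kp ^ 3.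
Proof.
intros Hx Hy Hz F Hp3 Hpp Hpv Hpa Hkm Hkp.
assert (E := cone_gradient_along_normal q p v n F Hpp Hpv).
assert (V := cone_tangent_value q p v n F Hpp Hpv).
set (l := diag_form q p n) in *; injection E; intros E3 E2 E1.
assert (Hl : l <> 0).
{ intros Z; rewrite Z in V.
  assert (N : cx q * cy q * cz q <> 0)
    by (repeat apply Rmult_integral_contrapositive_currified; trivial).
  apply N; lra. }
assert (K : l * kp = - cz q).
{ apply (Rmult_eq_reg_r (cz p ^ 2)); [|now apply pow_nonzero].
  replace (l * kp * cz p ^ 2) with (l * (kp * cz p ^ 2)) by ring.
  rewrite Hkp; replace (l * - (cz p * cz n)) with (- (cz p * (l * cz n))) by ring.
  rewrite <- E3; ring. }
assert (M : l * km = - diag_form q v v).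
{ replace (l * km) with (diag_form q p a); [lra|].
  rewrite Hkm; unfold dot3, diag_form; rewrite E1, E2, E3.
  unfold cx, cy, cz; simpl; ring. }
replace kp with (- cz q / l) by (rewrite <- K; field; trivial).
apply (Rmult_eq_reg_l (l ^ 3)); [|now apply pow_nonzero].
replace (l ^ 3 * km) with (l ^ 2 * (l * km)) by ring.
rewrite M; replace (l ^ 2 * - diag_form q v v) with (- (l ^ 2 * diag_form q v v)) by ring.
rewrite V; field; split; trivial.
Qed.

(** * Differentiating a quadratic equation along a curve *)

Lemma is_derive_locally_const (a b : Rbar) (f : R -> R) (c s d : R) :
  (forall r, in_interval a b r -> f r = c) -> in_interval a b s ->
  is_derive f s d -> d = 0.
Proof.
intros H Hs Hd.
assert (E : is_derive f s 0).
{ apply (is_derive_ext_loc (fun _ => c)); [|exact (is_derive_const c s)].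
  assert (O : open (in_interval a b))
    by (apply open_and; [apply open_Rbar_gt | apply open_Rbar_lt]).
  apply (filter_imp (in_interval a b)); [|exact (O s Hs)].
  intros r Hr; symmetry; exact (H r Hr). }
rewrite <- (is_derive_unique _ _ _ Hd); exact (is_derive_unique _ _ _ E).
Qed.

Definition differentiable3 (f : R -> vec3) (s : R) : Prop :=
  ex_derive (fun r => cx (f r)) s /\ ex_derive (fun r => cy (f r)) s /\
  ex_derive (fun r => cz (f r)) s.

Lemma is_derive_scal_mult (c : R) (f g : R -> R) (s : R) :
  ex_derive f s -> ex_derive g s ->
  is_derive (fun r => c * f r * g r) s
    (c * Derive f s * g s + c * f s * Derive g s).
Proof.
intros F G; auto_derive; [repeat split; assumption|].
change (Derive (fun r => f r)) with (Derive f).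
change (Derive (fun r => g r)) with (Derive g); ring.
Qed.

Lemma is_derive_diag_form (q : vec3) (f g : R -> vec3) (s : R) :
  differentiable3 f s -> differentiable3 g s ->
  is_derive (fun r => diag_form q (f r) (g r)) s
    (diag_form q (derive3 f s) (g s) + diag_form q (f s) (derive3 g s)).
Proof.
intros (F1 & F2 & F3) (G1 & G2 & G3).
assert (E := is_derive_plus _ _ _ _ _
  (is_derive_plus _ _ _ _ _ (is_derive_scal_mult (cx q) _ _ _ F1 G1)
                            (is_derive_scal_mult (cy q) _ _ _ F2 G2))
  (is_derive_scal_mult (cz q) _ _ _ F3 G3)).
replace (diag_form q (derive3 f s) (g s) + diag_form q (f s) (derive3 g s))
  with (plus (plus (cx q * Derive (fun r => cx (f r)) s * cx (g s)
                    + cx q * cx (f s) * Derive (fun r => cx (g r)) s)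
                   (cy q * Derive (fun r => cy (f r)) s * cy (g s)
                    + cy q * cy (f s) * Derive (fun r => cy (g r)) s))
             (cz q * Derive (fun r => cz (f r)) s * cz (g s)
              + cz q * cz (f s) * Derive (fun r => cz (g r)) s)).
{ exact E. }
unfold plus, diag_form, derive3, cx, cy, cz; simpl; ring.
Qed.

Lemma smooth_differentiable (a b : Rbar) (xi : R -> vec3) (s : R) :
  smooth_on a b xi -> in_interval a b s ->
  differentiable3 xi s /\ differentiable3 (derive3 xi) s.
Proof. intros H Hs; split; [exact (H 1%nat s Hs) | exact (H 2%nat s Hs)]. Qed.

Lemma diag_form_sym (q u v : vec3) : diag_form q u v = diag_form q v u.
Proof. unfold diag_form; ring. Qed.

Lemma curve_on_quadric_first_order (a b : Rbar) (xi : R -> vec3) (q : vec3) (c : R) :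
  smooth_on a b xi ->
  (forall r, in_interval a b r -> diag_form q (xi r) (xi r) = c) ->
  forall s, in_interval a b s -> diag_form q (xi s) (derive3 xi s) = 0.
Proof.
intros Hsm H s Hs; destruct (smooth_differentiable _ _ _ _ Hsm Hs) as [D _].
assert (E := is_derive_locally_const a b _ c s _ H Hs (is_derive_diag_form q xi xi s D D)).
rewrite (diag_form_sym q (derive3 xi s)) in E; lra.
Qed.

Lemma curve_on_quadric_second_order (a b : Rbar) (xi : R -> vec3) (q : vec3) (c : R) :
  smooth_on a b xi ->
  (forall r, in_interval a b r -> diag_form q (xi r) (xi r) = c) ->
  forall s, in_interval a b s ->
  diag_form q (derive3 xi s) (derive3 xi s)
  + diag_form q (xi s) (derive3 (derive3 xi) s) = 0.
Proof.
intros Hsm H s Hs; destruct (smooth_differentiable _ _ _ _ Hsm Hs) as [D D'].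
exact (is_derive_locally_const a b _ 0 s _
  (curve_on_quadric_first_order a b xi q c Hsm H) Hs (is_derive_diag_form q _ _ s D D')).
Qed.

(** * Rotating the normal back to the profile plane *)

Definition rotate_back (t : R) (nu : vec4) : vec3 :=
  (Defs.c1 nu, c2 nu, c3 nu * cos t + c4 nu * sin t).

(** Since [nu] is orthogonal to the parallel through the point, rotating it by
    [- t] kills its last coordinate, so [rotate_back] preserves its length. *)
Lemma rotate_back_orthonormal (xi : R -> vec3) (s t : R) (nu : vec4) :
  cz (xi s) <> 0 -> dot3 (xi s) (xi s) = 1 ->
  dot3 (derive3 xi s) (derive3 xi s) = 1 -> dot3 (xi s) (derive3 xi s) = 0 ->
  unit_normal (rot_surface xi) s t nu ->
  orthonormal (xi s) (derive3 xi s) (rotate_back t nu).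
Proof.
intros Hz Hp Hv Hpv (N1 & N2 & N3 & N4).
rewrite Ds_rot_surface in N3; rewrite Dt_rot_surface in N4.
assert (Ht := sin2_cos2 t); unfold Rsqr in Ht.
assert (T : c4 nu * cos t - c3 nu * sin t = 0).
{ apply (Rmult_eq_reg_l (cz (xi s))); trivial.
  rewrite Rmult_0_r, <- N4; unfold dot4, Defs.c1, c2, c3, c4; simpl; ring. }
repeat split; trivial.
- transitivity (Defs.c1 nu ^ 2 + c2 nu ^ 2
    + (c3 nu ^ 2 + c4 nu ^ 2) * (sin t * sin t + cos t * cos t)
    - (c4 nu * cos t - c3 nu * sin t) ^ 2).
  + unfold dot3, diag_form, rotate_back, cx, cy, cz; simpl; ring.
  + rewrite Ht, T; transitivity (dot4 nu nu); [unfold dot4; ring | exact N1].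
- rewrite <- N2; unfold dot3, diag_form, rotate_back, dot4, rot_surface,
    Defs.c1, c2, c3, c4, cx, cy, cz; simpl; ring.
- rewrite <- N3; unfold dot3, diag_form, rotate_back, dot4, rot_surface,
    Defs.c1, c2, c3, c4, cx, cy, cz; simpl; ring.
Qed.

Lemma meridian_curvature (xi : R -> vec3) (s t : R) (nu : vec4) (km : R) :
  dot3 (derive3 xi s) (derive3 xi s) = 1 ->
  principal_curvature (rot_surface xi) s t nu meridian km ->
  km = dot3 (derive3 (derive3 xi) s) (rotate_back t nu).
Proof.
intros Hv [_ H]; specialize (H meridian).
unfold second_form, first_form in H; rewrite Dss_rot_surface, Ds_rot_surface in H.
assert (Ht := sin2_cos2 t); unfold Rsqr in Ht.
assert (L : dot4 (rot_surface (derive3 xi) s t) (rot_surface (derive3 xi) s t)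
  = cx (derive3 xi s) ^ 2 + cy (derive3 xi s) ^ 2
    + cz (derive3 xi s) ^ 2 * (sin t * sin t + cos t * cos t))
  by (unfold dot4, rot_surface, Defs.c1, c2, c3, c4; cbn [fst snd]; ring).
assert (L' : dot4 (rot_surface (derive3 xi) s t) (rot_surface (derive3 xi) s t) = 1).
{ rewrite L, Ht; transitivity (dot3 (derive3 xi s) (derive3 xi s)); [|exact Hv].
  unfold dot3, diag_form, cx, cy, cz; simpl; ring. }
rewrite L' in H; unfold meridian in H; cbn [fst snd] in H.
transitivity (dot4 (rot_surface (derive3 (derive3 xi)) s t) nu); [lra|].
unfold dot3, diag_form, rotate_back, dot4, rot_surface, Defs.c1, c2, c3, c4, cx, cy, cz.
simpl; ring.
Qed.

Lemma parallel_curvature (xi : R -> vec3) (s t : R) (nu : vec4) (kp : R) :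
  principal_curvature (rot_surface xi) s t nu parallel kp ->
  kp * cz (xi s) ^ 2 = - (cz (xi s) * cz (rotate_back t nu)).
Proof.
intros [_ H]; specialize (H parallel).
unfold second_form, first_form in H; rewrite Dtt_rot_surface, Dt_rot_surface in H.
assert (Ht := sin2_cos2 t); unfold Rsqr in Ht.
unfold parallel, dot4, Defs.c1, c2, c3, c4 in H; cbn [fst snd] in H.
transitivity (kp * cz (xi s) ^ 2 * (sin t * sin t + cos t * cos t));
  [rewrite Ht; ring|].
unfold rotate_back, Defs.c1, c2, c3, c4; unfold cz at 3; cbn [fst snd]; lra.
Qed.

(** * Surfaces generated by cones *)

Lemma cubic_relation_of_cone (C : vec3 -> Prop) (q : vec3) :
  cx q <> 0 -> cy q <> 0 -> cz q <> 0 ->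
  (forall p, C p -> dot3 p p = 1 /\ diag_form q p p = 0) ->
  exists mu : R, mu <> 0 /\
    forall (a b : Rbar) (xi : R -> vec3),
      smooth_on a b xi -> unit_speed_on a b xi -> curve_in a b xi C ->
    forall s t : R, in_interval a b s -> cz (xi s) <> 0 ->
    forall nu : vec4, unit_normal (rot_surface xi) s t nu ->
    forall km kp : R,
      principal_curvature (rot_surface xi) s t nu meridian km ->
      principal_curvature (rot_surface xi) s t nu parallel kp ->
      km = mu * kp ^ 3.
Proof.
intros Hx Hy Hz HC.
exists (- (cx q * cy q) / cz q ^ 2); split.
{ apply Rmult_integral_contrapositive_currified.
  - now apply Ropp_neq_0_compat, Rmult_integral_contrapositive_currified.
  - now apply Rinv_neq_0_compat, pow_nonzero. }
intros a b xi Hsm Hu Hin s t Hs Hzs nu Hnu km kp Hkm Hkp.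
assert (HS : forall r, in_interval a b r -> dot3 (xi r) (xi r) = 1)
  by (intros r Hr; apply HC, Hin, Hr).
assert (HQ : forall r, in_interval a b r -> diag_form q (xi r) (xi r) = 0)
  by (intros r Hr; apply HC, Hin, Hr).
assert (Hv : dot3 (derive3 xi s) (derive3 xi s) = 1).
{ transitivity (cx (derive3 xi s) ^ 2 + cy (derive3 xi s) ^ 2 + cz (derive3 xi s) ^ 2);
  [unfold dot3, diag_form, cx, cy, cz; simpl; ring | exact (Hu s Hs)]. }
apply (cone_cubic_relation q (xi s) (derive3 xi s) (derive3 (derive3 xi) s)
         (rotate_back t nu)); trivial.
- apply rotate_back_orthonormal; trivial; [now apply HS|].
  exact (curve_on_quadric_first_order a b xi _ 1 Hsm HS s Hs).
- now apply HQ.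
- exact (curve_on_quadric_first_order a b xi _ 0 Hsm HQ s Hs).
- exact (curve_on_quadric_second_order a b xi _ 0 Hsm HQ s Hs).
- now apply meridian_curvature.
- now apply parallel_curvature.
Qed.

Lemma inv_sqr_sub1_neq0 (A : R) : 0 < A -> A <> 1 -> / A ^ 2 - 1 <> 0.
Proof.
intros H0 H1 E.
assert (P : A ^ 2 = 1) by (rewrite <- (Rinv_inv (A ^ 2)), (Rminus_diag_uniq _ _ E); apply Rinv_1).
apply H1; nra.
Qed.

Lemma CV_on_cone (A B : R) (p : vec3) : CV A B p ->
  dot3 p p = 1 /\ diag_form (/ A ^ 2 - 1, / B ^ 2 - 1, - 1) p p = 0.
Proof.
unfold CV, sphere2, dot3, diag_form, Rdiv; intros [S H].
destruct p as [[x y] z]; unfold cx, cy, cz in *; cbn [fst snd] in *.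
split; lra.
Qed.

Lemma CH_on_cone (C D : R) (p : vec3) : CH C D p ->
  dot3 p p = 1 /\ diag_form (/ C ^ 2 - 1, - 1, / D ^ 2 - 1) p p = 0.
Proof.
unfold CH, sphere2, dot3, diag_form, Rdiv; intros [S H].
destruct p as [[x y] z]; unfold cx, cy, cz in *; cbn [fst snd] in *.
split; lra.
Qed.

Theorem proposition5p5 :
  forall C : vec3 -> Prop, nondegenerate_quadric_conic C ->
  exists mu : R, mu <> 0 /\
    forall (a b : Rbar) (xi : R -> vec3),
      smooth_on a b xi -> unit_speed_on a b xi -> curve_in a b xi C ->
    forall s t : R, in_interval a b s -> cz (xi s) <> 0 ->
    forall nu : vec4, unit_normal (rot_surface xi) s t nu ->
    forall km kp : R,
      principal_curvature (rot_surface xi) s t nu meridian km ->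
      principal_curvature (rot_surface xi) s t nu parallel kp ->
      km = mu * kp ^ 3.
Proof.
assert (HV : forall A B, 0 < A -> A <> 1 -> 0 < B -> B <> 1 -> _)
  by exact (fun A B HA HA1 HB HB1 =>
    cubic_relation_of_cone (CV A B) (/ A ^ 2 - 1, / B ^ 2 - 1, - 1)
      (inv_sqr_sub1_neq0 A HA HA1) (inv_sqr_sub1_neq0 B HB HB1)
      (Ropp_neq_0_compat 1 R1_neq_R0) (CV_on_cone A B)).
assert (HH : forall C D, 0 < C -> C <> 1 -> 0 < D -> D <> 1 -> _)
  by exact (fun C D HC HC1 HD HD1 =>
    cubic_relation_of_cone (CH C D) (/ C ^ 2 - 1, - 1, / D ^ 2 - 1)
      (inv_sqr_sub1_neq0 C HC HC1) (Ropp_neq_0_compat 1 R1_neq_R0)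
      (inv_sqr_sub1_neq0 D HD HD1) (CH_on_cone C D)).
intros K [C D ? ? ? | A B ? ? ? | A B ? ? ? | C D ? ? ?];
  (apply HV || apply HH); lra.
Qed.
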